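(* Let $b \ge 3$ be an integer. An integer $n \ge b^2-1$ is not the comma-successor in base $b$ of any positive integer if and only if $n = c\cdot b^i$ for some integers $i \ge 2$ and $2 \le c \le b-1$.
   Context: Fix a base $b$. For a positive integer $n$, let $\delta(n)$ denote its leading (most significant, nonzero) base-$b$ digit. For positive integers $k, k'$, we say that $k'$ is a comma-child of $k$ (in base $b$) if $k' - k = d\cdot b + \delta(k')$, where $d = k \bmod b$ is the last base-$b$ digit of $k$. If $k$ has at least one comma-child, the comma-successor of $k$ is its smallest comma-child; otherwise $k$ has no comma-successor. *)

(* Defs.v *)
From mathcomp Require Import all_boot.

Set Implicit Arguments.
Unset Strict Implicit.
Unset Printing Implicit Defensive.

(* For b > 1 and n > 0, trunc_log b n is the largest e such that b ^ e <= n. *)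
Definition leading_digit (b n : nat) : nat := n %/ b ^ trunc_log b n.

(* The equation k' - k = d * b + leading_digit b k', written additively to
   avoid the truncated subtraction of nat. *)
Definition comma_child (b k k' : nat) : Prop :=
  [/\ 0 < k, 0 < k' & k' = k + ((k %% b) * b + leading_digit b k')].

Definition comma_successor (b k n : nat) : Prop :=
  comma_child b k n /\ (forall m : nat, comma_child b k m -> n <= m).

(* Main.v *)
(** The equation defining a comma-child [n] of [k] forces
    [k = n - leading_digit n] modulo [b], hence fixes the last digit of [k], so
    [n] is a comma-child of exactly one [k] (positive because [n >= b ^ 2 - 1]).
    Thus [n] fails to be a comma-successor iff this [k] has a smaller child [m].
    Then [n - m] is the difference of the leading digits of [n] and [m]; being
    at most [b - 2], it must equal [1], so [n] is the first number with its
    leading digit, i.e. [n = c * b ^ i] with [c >= 2]. *)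
Require Import Defs.
From mathcomp Require Import all_boot zify.

Lemma leading_digit_eq (b n i c : nat) :
  0 < c < b -> c * b ^ i <= n < c.+1 * b ^ i -> leading_digit b n = c.
Proof.
move=> /andP[c_gt0 c_lt] /andP[le_n lt_n].
have b_gt1 : 1 < b by lia.
have bi_gt0 : 0 < b ^ i by rewrite expn_gt0; lia.
rewrite /leading_digit (trunc_log_eq b_gt1 (n := i)); last first.
  by rewrite expnS; apply/andP; split; nia.
apply/eqP; rewrite eqn_leq -ltnS ltn_divLR // lt_n.
by rewrite leq_divRL.
Qed.

Lemma leading_digitP (b n : nat) (c := leading_digit b n)
    (i := trunc_log b n) :
  1 < b -> 0 < n -> 0 < c < b /\ c * b ^ i <= n < c.+1 * b ^ i.
Proof.
move=> b_gt1 n_gt0.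
have bi_gt0 : 0 < b ^ i by rewrite expn_gt0; lia.
have /andP[le_n lt_n] := trunc_log_bounds b_gt1 n_gt0.
split; last by rewrite leq_divM ltn_ceil.
by rewrite divn_gt0 // le_n ltn_divLR // -expnS.
Qed.

Lemma comma_child_exists (b n : nat) :
  3 <= b -> b ^ 2 - 1 <= n -> exists k, comma_child b k n.
Proof.
move=> b_ge3 n_ge.
have n_gt0 : 0 < n by rewrite -mulnn in n_ge; nia.
have [] := @leading_digitP b n (ltnW b_ge3) n_gt0.
set c := leading_digit b n => /andP[c_gt0 c_lt] _.
pose r := (n - c) %% b; pose q := (n - c) %/ b.
have r_lt : r < b by rewrite ltn_mod; lia.
have nE : n - c = q * b + r by apply: divn_eq.
rewrite -mulnn in n_ge.
(* From [c <= b - 1], [n - c] is at least [(b - 1) * b]. Hence [r <= q], and the truncated [q - r]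
   below is exact. *)
have q_ge : b.-1 <= q.
  rewrite leq_divRL; last by lia.
  nia.
have modE : ((q - r) * b + r) %% b = r by rewrite modnMDl modn_small.
(* The last digit must be [r]; the rest solves [k + r * b = q * b + r]. *)
exists ((q - r) * b + r); split=> //.
  by clearbody r q; clear modE; case: (posnP r) => ?; nia.
rewrite modE -/c addnA (addnAC _ r) -mulnDl subnK; last by lia.
by rewrite -nE subnK //; nia.
Qed.

Lemma comma_sibling_lt (b k m n : nat) :
  3 <= b -> b <= n -> comma_child b k m -> comma_child b k n -> m < n ->
  n = leading_digit b n * b ^ trunc_log b n /\ 1 < leading_digit b n.
Proof.
move=> b_ge3 b_le [k_gt0 m_gt0 mE] [_ n_gt0 nE] lt_mn.
have b_gt1 := ltnW b_ge3.
have [] := @leading_digitP b m b_gt1 m_gt0.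
have [] := @leading_digitP b n b_gt1 n_gt0.
move: mE nE; rewrite /leading_digit.
set i := trunc_log b n; set c := n %/ _; set e := m %/ _.
move=> mE nE /andP[c_gt0 c_lt] /andP[le_n lt_n] /andP[e_gt0 e_lt] _.
have i_gt0 : 0 < i by rewrite trunc_log_gt0; lia.
have bi_ge3 : 3 <= b ^ i.
  by apply: leq_trans b_ge3 _; rewrite -{1}(expn1 b) leq_exp2l.
have nmE : n = m + (c - e) by lia.
have c_gt1 : 1 < c by lia.
(* Removing [c - e < c] from [n >= c * b ^ i] leaves at least [b ^ i], so [m] has as many digits as
   [n]. *)
have log_m : trunc_log b m = i.
  by apply: trunc_log_eq => //; rewrite expnS; apply/andP; split; nia.
have m_lt : m < e.+1 * b ^ i.
  by rewrite /e log_m ltn_ceil //; lia.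
have cE : c = e.+1.
  apply/eqP; rewrite eqn_leq; apply/andP; split; last by lia.
  (* If [c - e >= 2], then [n - m > (c - e - 1) * b ^ i >= c - e], contradicting [nmE]. *)
  rewrite leqNgt; apply/negP => lt_ec.
  have [t tE] : exists t, c = e.+2 + t by exists (c - e.+2); lia.
  nia.
split=> //.
(* Now [n = m + 1] and [m < c * b ^ i <= n]. *)
by rewrite -cE in m_lt; lia.
Qed.

(** As [c > 1], the predecessor keeps its length and has leading digit [c - 1], so both sides of the
    equation drop by one. *)
Lemma comma_child_pred (b k i c : nat) :
  1 < c < b -> 0 < i -> comma_child b k (c * b ^ i) ->
  comma_child b k (c * b ^ i).-1.
Proof.
move=> /andP[c_gt1 c_lt] i_gt0 [k_gt0 n_gt0 nE].
have bi_gt1 : 1 < b ^ i by rewrite -(exp1n i) ltn_exp2r //; lia.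
have dn : leading_digit b (c * b ^ i) = c.
  by apply: (@leading_digit_eq _ _ i); [lia | apply/andP; split; nia].
have dm : leading_digit b (c * b ^ i).-1 = c.-1.
  by apply: (@leading_digit_eq _ _ i); [lia | apply/andP; split; nia].
rewrite dn in nE.
by split=> //; rewrite ?dm; nia.
Qed.

Theorem theorem5p4 (b : nat) (hb : 3 <= b) (n : nat) (hn : b ^ 2 - 1 <= n) :
  ~ (exists k : nat, 0 < k /\ comma_successor b k n) <->
  exists i c : nat, [/\ 2 <= i, 2 <= c, c <= b - 1 & n = c * b ^ i].
Proof.
split=> [not_succ | [i [c [i_ge2 c_ge2 c_le nE]]] [k [_ [child_n min_n]]]].
  have b_le : b <= n by rewrite -mulnn in hn; nia.
  have n_gt0 : 0 < n by lia.
  have [] := @leading_digitP b n (ltnW hb) n_gt0.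
  set c := leading_digit b n; set i := trunc_log b n => /andP[c_gt0 c_lt] _.
  have [/andP[/eqP nE c_gt1] | not_form] := boolP ((n == c * b ^ i) && (1 < c)).
    exists i, c; split=> //; last by lia.
    (* For [i <= 1], [c * b ^ i <= (b - 1) * b < b ^ 2 - 1]. *)
    rewrite ltnNge; apply/negP => i_le1.
    have bi_le : b ^ i <= b by rewrite -{2}(expn1 b) leq_exp2l //; lia.
    by rewrite -mulnn in hn; nia.
  have [k child_n] := comma_child_exists _ _ hb hn.
  case: not_succ; exists k; split; first by case: child_n.
  split=> // m child_m; rewrite leqNgt; apply/negP => lt_mn.
  have [nE c_gt1] := comma_sibling_lt _ _ _ _ hb b_le child_m child_n lt_mn.
  by case/negP: not_form; rewrite c_gt1 andbT; apply/eqP.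
have n_gt0 : 0 < n by case: child_n.
rewrite nE in child_n.
have := min_n _ (comma_child_pred _ _ _ _ (ltac:(lia) : 1 < c < b) (ltnW i_ge2) child_n).
by lia.
Qed.
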